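(* Let $X_1,\dots,X_n$ be the observations. Let $\widehat g_n^0=e^{\widehat\psi_n^0}\in\mathcal{SLC}_0$, where $\widehat\psi_n^0$ is continuous and piecewise linear on $[-|X|_{(n)},|X|_{(n)}]$ with knots contained in $\{-|X|_{(n)},\dots,-|X|_{(1)},0,|X|_{(1)},\dots,|X|_{(n)}\}$, and equals $-\infty$ outside $[-|X|_{(n)},|X|_{(n)}]$. Let $\widehat g_n^+=2\widehat g_n^0$, $$\widehat G_{n,R}^+(x)=\int_x^{|X|_{(n)}}\widehat g_n^+(y)\,dy,\qquad \mathbb{F}_{n,R}^+(x)=\frac1n\sum_{i=1}^n 1\{|X|_{(i)}\ge x\}.$$ Then $\widehat g_n^0$ is the maximum likelihood estimator over $\mathcal{SLC}_0$ if and only if $$\int_t^{|X|_{(n)}}\widehat G_{n,R}^+(x)\,dx\ \le\ \int_t^{|X|_{(n)}}\mathbb{F}_{n,R}^+(x)\,dx\qquad\text{for all } t\in[0,|X|_{(n)}],$$ with equality whenever $t\in\mathcal{S}_n(\widehat\psi_n^0)\cap[0,|X|_{(n)}]$.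
   Context: $X_1,\dots,X_n$ are i.i.d. from a density on $\mathbb{R}$; $|X|_{(1)}<\dots<|X|_{(n)}$ are the order statistics of $|X_1|,\dots,|X_n|$. $\mathcal{C}$ is the class of concave, closed, proper functions $\varphi:\mathbb{R}\to[-\infty,\infty)$. $\mathcal{SC}_0$ is the class of $\varphi\in\mathcal{C}$ with $\varphi(0)\ge\varphi(x)$ and $\varphi(-x)=\varphi(x)$ for all $x$, and $\mathcal{SLC}_0=\{e^{\varphi}:\varphi\in\mathcal{SC}_0,\ \int e^{\varphi}\,d\lambda=1\}$. The MLE over $\mathcal{SLC}_0$ is $e^{\psi}$ where $\psi$ maximizes over $\mathcal{SC}_0$ the criterion $\Psi_n(\varphi)=\frac1n\sum_{i=1}^n\varphi(X_i)-\int_{\mathbb{R}}e^{\varphi(x)}\,dx$. For a continuous piecewise linear $h:[A,B]\to\mathbb{R}$, its set of knots is $\mathcal{S}_n(h)=\{t\in(A,B):h'(t-)\ne h'(t+)\}\cup\{A,B\}$; for $\widehat\psi_n^0$ one takes $A=-|X|_{(n)}$, $B=|X|_{(n)}$. *)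

(* Defs.v *)
From mathcomp Require Import all_boot all_order all_algebra.
From mathcomp Require Import all_classical all_reals all_analysis.
Set Implicit Arguments.
Unset Strict Implicit.
Unset Printing Implicit Defensive.
Import Order.TTheory GRing.Theory Num.Theory.
Import numFieldNormedType.Exports.
Local Open Scope classical_set_scope.
Local Open Scope ring_scope.

Section Classes.
Context {R : realType}.
Implicit Types (phi : R -> \bar R) (g : R -> \bar R).

(* Weights are in (0, 1), and [concave] is only used together with
   [phi x < +oo], so no indeterminate sum occurs. *)
Definition concave phi : Prop :=
  forall (x y t : R), 0 < t -> t < 1 ->
    (t%:E * phi x + (1 - t)%:E * phi y <= phi (t * x + (1 - t) * y)%R)%E.

(* For a proper concave function, closed means upper semicontinuous. *)
Definition closed_fun phi : Prop :=
  lower_semicontinuous (fun x => - phi x)%E.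

Definition proper_fun phi : Prop :=
  (forall x, phi x < +oo)%E /\ (exists x, -oo < phi x)%E.

Definition classC : set (R -> \bar R) :=
  [set phi | [/\ concave phi, closed_fun phi & proper_fun phi]].

Definition classSC0 : set (R -> \bar R) :=
  [set phi | [/\ classC phi,
                 forall x, (phi x <= phi 0%R)%E &
                 forall x, phi (- x) = phi x]].

(* [expeR -oo = 0], so densities vanish where the log-density is -oo. *)
Definition classSLC0 : set (R -> \bar R) :=
  [set g | exists phi, [/\ classSC0 phi, g = (fun x => expeR (phi x)) &
     (\int[lebesgue_measure]_x expeR (phi x) = 1)%E]].

End Classes.

Section PiecewiseLinear.
Context {R : realType}.
Implicit Types (A B : R) (h : R -> R).

(* [A :: s] is the list of subdivision points, ending at [B]; the knots
   are among the subdivision points, but not conversely. *)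
Definition continuous_piecewise_linear A B h : Prop :=
  {within `[A, B], continuous h} /\
  exists s : seq R, [/\ path <%R A s, last A s = B &
    forall i, (i < size s)%N -> exists a b : R,
      forall x, nth A (A :: s) i < x < nth A (A :: s) i.+1 ->
        h x = a * x + b].

(* [lim] is a total operator; both limits below do exist when [h] is
   continuous piecewise linear on a neighbourhood of [t]. *)
Definition left_derivative h (t : R) : R :=
  lim ((h (t + s) - h t) / s @[s --> 0^'-]).

Definition right_derivative h (t : R) : R :=
  lim ((h (t + s) - h t) / s @[s --> 0^'+]).

Definition knots A B h : set R :=
  [set t | A < t < B /\ left_derivative h t <> right_derivative h t]
  `|` [set A; B].

End PiecewiseLinear.

Section Sample.
Context {R : realType} {n : nat}.
Implicit Types (X : 'I_n -> R) (phi psi g : R -> \bar R).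

(* The indices start at 0: [abs_os X i] is |X|_(i+1). *)
Definition abs_os X (i : nat) : R :=
  nth 0 (sort <=%R [seq `|X j| | j <- enum 'I_n]) i.

Definition abs_max X : R := abs_os X n.-1.

(* No indeterminate form +oo - +oo occurs when [phi] is proper: the sum is
   < +oo and the integral is >= 0. *)
Definition criterion X phi : \bar R :=
  ((n%:R^-1 : R)%:E * (\sum_(i < n) phi (X i))
   - \int[lebesgue_measure]_x expeR (phi x))%E.

Definition is_MLE_SLC0 X g : Prop :=
  exists psi, [/\ classSC0 psi,
    forall phi, classSC0 phi -> (criterion X phi <= criterion X psi)%E &
    g = (fun x => expeR (psi x))].

Definition ghat_plus psi (y : R) : \bar R := (2%:E * expeR (psi y))%E.

Definition Ghat_plus_R X psi (x : R) : \bar R :=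
  (\int[lebesgue_measure]_(y in `[x, abs_max X]) ghat_plus psi y)%E.

Definition Fn_plus_R X (x : R) : R :=
  n%:R^-1 * \sum_(i < n) (x <= abs_os X i)%R%:R.

Definition admissible_knots X : set R :=
  [set t | t = 0 \/ exists i : 'I_n, t = abs_os X i \/ t = - abs_os X i].

End Sample.

(* Main.v *)
Require Import Defs.
From mathcomp Require Import all_boot all_order all_algebra.
From mathcomp Require Import all_classical all_reals all_analysis.
From mathcomp Require Import measurable_realfun.
From mathcomp Require Import ring lra.
Import Order.TTheory GRing.Theory Num.Theory.
Import numFieldNormedType.Exports.
Local Open Scope classical_set_scope.
Local Open Scope ring_scope.

(** Let M = |X|_(n).  An even, concave, piecewise linear function with maximum
at 0 is, on [-M, M], a tent: a constant minus a combination with nonnegative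
weights of the hinges h_t(x) = max(0, |x| - t), t >= 0, and its knots in [0, M)
are the t that occur with positive weight (tent_representation, tent_knotP).  The
theorem says that the stationarity conditions of a concave maximization
problem need only be tested on hinges.

The link with the integrated tails is that, for g = exp psi, exchanging the
integrals and using that g is even gives
  int_t^M int_x^M 2 g(y) dy dx = int_{-M}^M h_t g
(iterated_integral_hinge), while the integral over [t, M] of the empirical
tail is the sample mean of h_t (integral_Fn).  The asserted inequality thus
says that gap(t) = mean h_t - int h_t g is nonnegative, and the equality says
that it vanishes at the knots.

If psi is a maximizer, subtracting e h_t from psi stays inside the class for
every t >= 0 and every e > 0, which gives gap(t) >= 0; at a knot t < M the
weight of h_t in psi is positive, so a small multiple of h_t can also be
added back, which gives gap(t) <= 0 (tent_objective_necessary).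

Conversely, a competitor phi whose criterion is not -oo is finite at the
observations, hence on [-M, M].  Interpolating it linearly between 0 and the
|X_i| and setting it to -oo outside [-M, M] gives a tent below phi that agrees
with phi at the observations: the sample mean is unchanged and the integral of
the exponential decreases, so only tents have to be compared with psi
(criterion_le_tent).  For a tent p, the inequality exp p >= g (1 + p - psi)
bounds the increase of the criterion by mean (p - psi) - int (p - psi) g.  As
int g = 1, constants contribute nothing, so this is the sum of weight * gap
over the kinks of psi, which is zero, minus the same sum over the kinks of p,
which is nonnegative (tent_objective_max). *)

(** * Piecewise linear interpolation of a concave function *)

Section Interpolation.
Context {R : realType}.
Implicit Types (f p : R -> R) (s : seq R) (L : seq (R * R)).

(** Concavity on [a, b] as decreasing chord slopes, with the denominators
cleared so that no quotient has to be handled. *)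
Definition chord_concave (a b : R) f : Prop := forall x y z,
  a <= x -> x < y -> y < z -> z <= b ->
  (f z - f y) * (y - x) <= (f y - f x) * (z - y).

(** Chords are cross-multiplied to avoid quotients, and the recursion follows the
list of subdivision points so that proofs peel off the leftmost piece. *)
Fixpoint interpolates f p (a : R) s : Prop :=
  if s is c :: s' then
    (forall x, a <= x <= c -> (p x - f a) * (c - a) = (f c - f a) * (x - a))
    /\ interpolates f p c s'
  else p a = f a.

Fixpoint piecewise_affine f (a : R) s : Prop :=
  if s is c :: s' then
    (exists u v, forall x, a <= x <= c -> f x = u * x + v)
    /\ piecewise_affine f c s'
  else True.

Lemma path_le_last (a : R) s : path <%R a s -> a <= last a s.
Proof.
elim: s a => [|c s ih] a //= /andP[ac cs].
exact: le_trans (ltW ac) (ih _ cs).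
Qed.

Lemma chord_concaveS a b a' b' f : a <= a' -> b' <= b ->
  chord_concave a b f -> chord_concave a' b' f.
Proof.
move=> aa bb cf x y z ax xy yz zb.
by apply: cf => //; [exact: le_trans ax|exact: le_trans bb].
Qed.

Lemma eq_interpolates f p q a s : path <%R a s ->
  (forall x, a <= x <= last a s -> p x = q x) ->
  interpolates f q a s -> interpolates f p a s.
Proof.
elim: s a => [|c s ih] a /=.
  by move=> _ pq <-; rewrite pq// lexx.
move=> /andP[ac cs] pq [qc qs]; have cl := path_le_last _ _ cs.
split; last first.
  apply: ih => // x /andP[cx xl]; apply: pq.
  by rewrite xl (le_trans (ltW ac)).
move=> x /andP[ax xc]; rewrite pq ?qc ?ax ?xc//=.
exact: le_trans cl.
Qed.

(** The interpolant is built from the left: at each subdivision point the slope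
changes from sigma to the slope of the next chord, and the drop is nonnegative
because f is concave.  The incoming slope sigma is left free: this makes the
induction go through, and sigma = 0 is the value needed for a function with
maximum at a. *)
Lemma concave_interpolation f s (a sigma : R) : path <%R a s ->
  chord_concave a (last a s) f ->
  (forall c s', s = c :: s' -> f c - f a <= sigma * (c - a)) ->
  exists L, [/\ all (fun k => 0 <= k.1) L, all (fun k => a <= k.2) L &
    interpolates f (fun x => f a + sigma * (x - a)
        - \sum_(k <- L) k.1 * Num.max 0 (x - k.2)) a s].
Proof.
elim: s a sigma => [|c s ih] a sigma /=.
  by move=> _ _ _; exists [::]; split => //=; rewrite big_nil; ring.
move=> /andP[ac cs] cf slope.
have cl := path_le_last _ _ cs.
have ca0 : 0 < c - a by rewrite subr_gt0.
set tau := (f c - f a) / (c - a).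
have tauE : f c - f a = tau * (c - a) by rewrite /tau divfK// gt_eqF.
have [||L [L0 La iL]] := ih c tau cs.
- exact: chord_concaveS (ltW ac) (lexx _) cf.
- move=> d s' sE; have cd : c < d by move: cs; rewrite sE /= => /andP[].
  have dl : d <= last c s.
    by rewrite sE /=; apply: path_le_last; move: cs; rewrite sE /= => /andP[].
  have := cf a c d (lexx _) ac cd dl.
  rewrite tauE mulrAC => h.
  by rewrite -(ler_pM2r ca0).
exists ((sigma - tau, a) :: L); split => /=.
- rewrite L0 andbT subr_ge0 -(ler_pM2r ca0) -tauE.
  exact: slope.
- rewrite lexx /=; apply: sub_all La => k /=.
  exact: le_trans (ltW ac).
- split.
    move=> x /andP[ax xc].
    rewrite big_cons /= big_seq big1 => [|k kL].
      by rewrite addr0 (max_idPr _) ?subr_ge0// tauE; ring.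
    rewrite (max_idPl _) ?mulr0// subr_le0 (le_trans xc)//.
    by move/allP: La => /(_ _ kL).
  apply: eq_interpolates iL => // x /andP[cx xl].
  rewrite big_cons /= (max_idPr _); last by rewrite subr_ge0 (le_trans (ltW ac)).
  have -> : f c = f a + tau * (c - a) by rewrite -tauE; ring.
  by ring.
Qed.

Lemma interpolates_le f p a s : path <%R a s ->
  chord_concave a (last a s) f -> interpolates f p a s ->
  forall x, a <= x <= last a s -> p x <= f x.
Proof.
elim: s a => [|c s ih] a /=.
  by move=> _ _ pf x; rewrite -eq_le => /eqP <-; rewrite pf.
move=> /andP[ac cs] cf [pc ps] x /andP[ax xl].
have cl := path_le_last _ _ cs.
have [xc|cx] := leP x c; last first.
  by apply: (ih c) => //; [exact: chord_concaveS (ltW ac) (lexx _) cf|rewrite (ltW cx)].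
have ca0 : 0 < c - a by rewrite subr_gt0.
have := pc x; rewrite ax xc => /(_ isT) pE.
move: ax; rewrite le_eqVlt => /predU1P[<-|ax].
  have := pc a; rewrite lexx (ltW ac) subrr mulr0 => /(_ isT)/eqP.
  by rewrite mulf_eq0 (gt_eqF ca0) orbF subr_eq0 => /eqP ->.
rewrite -(ler_pM2r ca0).
move: xc; rewrite le_eqVlt => /predU1P[xc|xc].
  by rewrite xc in pE *; lra.
have := cf a x c (lexx _) ax xc cl.
nra.
Qed.

Lemma interpolates_eq f p a s : path <%R a s -> interpolates f p a s ->
  {in a :: s, p =1 f}.
Proof.
elim: s a => [|c s ih] a /=.
  by move=> _ pf x; rewrite inE => /eqP ->.
move=> /andP[ac cs] [pc ps] x; rewrite inE => /predU1P[->|]; last exact: ih.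
have ca0 : 0 < c - a by rewrite subr_gt0.
have := pc a; rewrite lexx (ltW ac) subrr mulr0 => /(_ isT)/eqP.
by rewrite mulf_eq0 (gt_eqF ca0) orbF subr_eq0 => /eqP ->.
Qed.

Lemma interpolates_affine f p a s : path <%R a s -> interpolates f p a s ->
  piecewise_affine f a s -> forall x, a <= x <= last a s -> p x = f x.
Proof.
elim: s a => [|c s ih] a /=.
  by move=> _ pf _ x; rewrite -eq_le => /eqP <-; rewrite pf.
move=> /andP[ac cs] [pc ps] [[u [v fE]] fs] x /andP[ax xl].
have [xc|cx] := leP x c; last by apply: (ih c) => //; rewrite (ltW cx).
have ca0 : c - a != 0 by rewrite gt_eqF// subr_gt0.
have := pc x; rewrite ax xc => /(_ isT) pE.
apply: (mulIf ca0); move: pE.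
rewrite (fE a) ?lexx ?ltW// (fE c) ?lexx ?ltW// (fE x) ?ax//.
lra.
Qed.

(** For even functions only the part of a subdivision to the right of 0 matters;
the piece that contains 0 is cut there. *)
Lemma piecewise_affine_from0 f (a : R) s : path <%R a s ->
  piecewise_affine f a s -> a <= 0 <= last a s ->
  exists s', [/\ path <%R 0 s', last 0 s' = last a s & piecewise_affine f 0 s'].
Proof.
elim: s a => [|c s ih] a /=.
  by move=> _ _; rewrite -eq_le => /eqP ->; exists [::].
move=> /andP[ac cs] [[u [v fE]] fs] /andP[a0 l0].
have [c0|c0] := leP c 0; first by apply: (ih c) => //; rewrite c0.
exists (c :: s); split => //=; first by rewrite c0.
split => //; exists u, v => x /andP[x0 xc]; apply: fE.
by rewrite xc (le_trans a0).
Qed.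

Lemma subdivision_through (M : R) (S : seq R) : 0 < M ->
  (forall x, x \in S -> 0 <= x <= M) ->
  exists s, [/\ path <%R 0 s, last 0 s = M & {subset S <= 0 :: s}].
Proof.
move=> M0 SM.
pose s := sort <=%R (undup [seq x <- S | 0 < x < M]).
exists (rcons s M); split; rewrite ?last_rcons//.
- have sP x : x \in s -> 0 < x < M.
    by rewrite mem_sort mem_undup mem_filter => /andP[].
  have ss : sorted <%R s by rewrite sort_lt_sorted undup_uniq.
  rewrite rcons_path; apply/andP; split.
    by case: s sP ss => //= x s /(_ x); rewrite mem_head => /(_ isT) /andP[-> _].
  case/lastP: s sP {ss} => [//|s x] sP; rewrite last_rcons.
  by have := sP x; rewrite mem_rcons mem_head => /(_ isT) /andP[].
- move=> x xS; have := SM x xS => /andP[x0 xM].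
  rewrite in_cons mem_rcons in_cons mem_sort mem_undup mem_filter xS andbT.
  move: x0 xM; rewrite le_eqVlt eq_sym => /predU1P[->|->]; rewrite ?eqxx//.
  by rewrite le_eqVlt => /predU1P[->|->]; rewrite ?eqxx ?orbT.
Qed.

End Interpolation.

(** * Tents: even concave functions as combinations of hinges *)

Section Tents.
Context {R : realType}.
Implicit Types (L : seq (R * R)) (C M t x y : R).

Definition hinge t x : R := Num.max 0 (`|x| - t).

(** Each pair in L is a drop of slope together with the place where it occurs. *)
Definition tent C L x : R := C - \sum_(k <- L) k.1 * hinge k.2 x.

Definition tent_log_density M C L x : \bar R :=
  if `|x| <= M then (tent C L x)%:E else -oo%E.

Lemma hinge_ge0 t x : 0 <= hinge t x.
Proof. by rewrite /hinge le_max lexx. Qed.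

Lemma hinge_norm t x : hinge t `|x| = hinge t x.
Proof. by rewrite /hinge normr_id. Qed.

Lemma hingeN t x : hinge t (- x) = hinge t x.
Proof. by rewrite /hinge normrN. Qed.

Lemma hinge_le M t x : 0 <= t -> `|x| <= M -> hinge t x <= M.
Proof.
move=> t0 xM; rewrite /hinge ge_max (le_trans _ xM)//=.
by rewrite (le_trans _ xM)// gerBl.
Qed.

Lemma hinge_out M t x : M <= t -> `|x| <= M -> hinge t x = 0.
Proof. by move=> Mt xM; rewrite /hinge (max_idPl _)// subr_le0 (le_trans xM). Qed.

Lemma hinge_convex t x y (r : R) : 0 < r -> r < 1 ->
  hinge t (r * x + (1 - r) * y) <= r * hinge t x + (1 - r) * hinge t y.
Proof.
move=> r0 r1; have s0 : 0 < 1 - r by rewrite subr_gt0.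
have hx := hinge_ge0 t x; have hy := hinge_ge0 t y.
rewrite {1}/hinge ge_max; apply/andP; split; first by nra.
have xx : `|x| - t <= hinge t x by rewrite /hinge le_max lexx orbT.
have yy : `|y| - t <= hinge t y by rewrite /hinge le_max lexx orbT.
have : `|r * x + (1 - r) * y| <= r * `|x| + (1 - r) * `|y|.
  by rewrite (le_trans (ler_normD _ _))// !normrM (gtr0_norm r0) (gtr0_norm s0).
nra.
Qed.

Lemma hinge_continuous t : continuous (hinge t).
Proof.
move=> x; apply: (@continuous_max _ _ (fun=> 0) (fun y => `|y| - t)).
  exact: cvg_cst.
apply: (@cvgB _ R); [exact: (@norm_continuous _ R)|exact: cvg_cst].
Qed.

Lemma tent_norm C L x : tent C L `|x| = tent C L x.
Proof. by congr (_ - _); apply: eq_bigr => k _; rewrite hinge_norm. Qed.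

Lemma tentN C L x : tent C L (- x) = tent C L x.
Proof. by rewrite -tent_norm normrN tent_norm. Qed.

Lemma tent_cons C L (d t x : R) :
  tent C ((d, t) :: L) x = tent C L x - d * hinge t x.
Proof. by rewrite /tent big_cons /=; ring. Qed.

Lemma tent_continuous C L : continuous (tent C L).
Proof.
elim: L => [|[d t] L ih].
  rewrite (_ : tent C [::] = cst C); first by move=> x; exact: cvg_cst.
  by apply/funext => x; rewrite /tent big_nil subr0.
rewrite (_ : tent C _ = fun x => tent C L x - d * hinge t x); last first.
  by apply/funext => x; rewrite tent_cons.
move=> x; apply: cvgB; first exact: ih.
by apply: cvgM; [exact: cvg_cst|exact: hinge_continuous].
Qed.

Lemma tent_le C L x : all (fun k => 0 <= k.1) L -> tent C L x <= C.
Proof.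
move=> /allP L0; rewrite gerBl big_seq sumr_ge0// => k kL.
by rewrite mulr_ge0 ?hinge_ge0// L0.
Qed.

Lemma tent0 C L : all (fun k => 0 <= k.2) L -> tent C L 0 = C.
Proof.
move=> /allP L0; rewrite /tent big_seq big1 ?subr0// => k kL.
by rewrite (hinge_out 0) ?mulr0 ?normr0 ?L0.
Qed.

Lemma tent_concave C L x y (r : R) : all (fun k => 0 <= k.1) L ->
  0 < r -> r < 1 ->
  r * tent C L x + (1 - r) * tent C L y <= tent C L (r * x + (1 - r) * y).
Proof.
move=> + r0 r1; elim: L => [|[d t] L ih] /=.
  by move=> _; rewrite /tent !big_nil; lra.
move=> /andP[d0 /ih{}ih]; rewrite !tent_cons.
have := ler_wpM2l d0 (hinge_convex t x y r r0 r1).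
lra.
Qed.

Lemma tent_log_density_SC0 M C L : 0 < M ->
  all (fun k => 0 <= k.1) L -> all (fun k => 0 <= k.2) L ->
  classSC0 (tent_log_density M C L).
Proof.
move=> M0 L1 L2; split.
- split.
  + move=> x y r r0 r1; rewrite /tent_log_density.
    have s0 : 0 < 1 - r by rewrite subr_gt0.
    case: (leP `|x| M) => xM; last first.
      by rewrite gt0_muleNy ?lte_fin// leNye.
    case: (leP `|y| M) => yM; last first.
      by rewrite gt0_muleNy ?lte_fin// addeNy leNye.
    rewrite ifT; first by rewrite -!EFinM -EFinD lee_fin tent_concave.
    rewrite (le_trans (ler_normD _ _))// !normrM (gtr0_norm r0) (gtr0_norm s0); nra.
  + move=> x a; rewrite /tent_log_density.
    case: (leP `|x| M) => xM; last first.
      move=> _; exists [set y | M < `|y|]; last first.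
        by move=> y /=; rewrite ltNge => /negbTE ->; rewrite /= ltry.
      by have /(_ [set z | M < z]) := @norm_continuous _ R x; apply; exact: lt_nbhsr.
    rewrite /= lte_fin => ax; exists [set y | a < - tent C L y]; last first.
      by move=> y /= ay; case: ifP => _; rewrite ?oppeNy ?ltry// -EFinN lte_fin.
    have : continuous (fun y => - tent C L y).
      by move=> y; apply: (@cvgN _ R); exact: tent_continuous.
    by move=> /(_ x [set z | a < z]); apply; exact: lt_nbhsr.
  + split; first by move=> x; rewrite /tent_log_density; case: ifP; rewrite ?ltry.
    by exists 0; rewrite /tent_log_density normr0 ltW// ltNyr.
- move=> x; rewrite /tent_log_density normr0 (ltW M0) tent0//.
  by case: ifP; rewrite ?leNye// lee_fin tent_le.
- by move=> x; rewrite /tent_log_density normrN tentN.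
Qed.

(** A point of [-M, M] lies between the two points M and -M, where phi is
finite by evenness, so concavity bounds phi from below. *)
Lemma SC0_fin (phi : R -> \bar R) M x : classSC0 phi ->
  phi M \is a fin_num -> `|x| <= M -> phi x \is a fin_num.
Proof.
move=> [[cphi _ [phiy _]] phi0 phiN] phiM xM.
rewrite fin_numElt phiy andbT.
have phiM' : (-oo < phi M)%E by move: phiM; rewrite fin_numElt => /andP[].
have [->//|Mx] := eqVneq x M.
have [->|MNx] := eqVneq x (- M); first by rewrite phiN.
have [xl xr] : - M < x /\ x < M.
  by move: xM; rewrite ler_norml !lt_neqAle eq_sym Mx MNx => /andP[-> ->].
have M0 : 0 < M + M by lra.
have := cphi M (- M) ((x + M) / (M + M)).
rewrite divr_gt0 ?ltr_pdivrMr ?mul1r ?ltrD2r//; last by rewrite -ltrBlDr sub0r.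
move=> /(_ isT xr); rewrite phiN -(fineK phiM) -!EFinM -EFinD.
rewrite (_ : (x + M) / (M + M) * M + _ = x); last by field; rewrite gt_eqF.
by apply: lt_le_trans; rewrite ltNyr.
Qed.

Lemma SC0_chord_concave (phi : R -> \bar R) M : classSC0 phi ->
  phi M \is a fin_num -> chord_concave 0 M (fun x => fine (phi x)).
Proof.
move=> SCphi phiM x y z x0 xy yz zM.
have yM : 0 < z - x by rewrite subr_gt0 (lt_trans xy).
have fin u : 0 <= u -> u <= M -> phi u \is a fin_num.
  by move=> u0 uM; apply: (SC0_fin _ _ _ SCphi phiM); rewrite ger0_norm.
have fx : phi x \is a fin_num by apply: fin => //; lra.
have fy : phi y \is a fin_num by apply: fin => //; lra.
have fz : phi z \is a fin_num by apply: fin => //; lra.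
have [[cphi _ _] _ _] := SCphi.
have := cphi x z ((z - y) / (z - x)).
have wx : 0 < (z - y) / (z - x) by rewrite divr_gt0// subr_gt0.
have wy : (z - y) / (z - x) < 1 by rewrite ltr_pdivrMr// mul1r ltrD2l ltrN2.
move=> /(_ wx wy).
rewrite (_ : (z - y) / (z - x) * x + _ = y); last by field; rewrite gt_eqF.
rewrite -(fineK fx) -(fineK fy) -(fineK fz) -!EFinM -EFinD lee_fin /=.
rewrite -(ler_pM2r yM).
rewrite (_ : (_ + _) * _ = (z - y) * fine (phi x) + (y - x) * fine (phi z)).
  lra.
by field; rewrite gt_eqF.
Qed.

(** Since phi is maximal at 0 its first chord slope is at most 0, so 0 is a
legitimate incoming slope: the interpolant then has no linear term and extends
to an even function. *)
Lemma SC0_tent_interpolation (phi : R -> \bar R) M s : 0 < M -> classSC0 phi ->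
  phi M \is a fin_num -> path <%R 0 s -> last 0 s = M ->
  exists L, [/\ all (fun k => 0 <= k.1) L, all (fun k => 0 <= k.2) L &
    interpolates (fun x => fine (phi x)) (tent (fine (phi 0)) L) 0 s].
Proof.
move=> M0 SCphi phiM ps ls.
have [[cphi _ _] phi0 phiN] := SCphi.
have [||L [L1 L2 iL]] := concave_interpolation (fun x => fine (phi x)) s 0 0 ps.
- by rewrite ls; exact: SC0_chord_concave.
- move=> c s' sE; rewrite mul0r subr_le0 fine_le//.
    apply: (SC0_fin _ _ _ SCphi phiM); rewrite -ls sE.
    by move: ps; rewrite sE /= => /andP[c0 cs]; rewrite gtr0_norm// path_le_last.
  by apply: (SC0_fin _ _ _ SCphi phiM); rewrite normr0 ltW.
exists L; split => //; apply: eq_interpolates iL => // x /andP[x0 _].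
rewrite mul0r addr0 /tent; congr (_ - _); apply: eq_bigr => k _.
by rewrite /hinge ger0_norm.
Qed.

Lemma SC0_tent_minorant (phi : R -> \bar R) M (S : seq R) : 0 < M ->
  classSC0 phi -> phi M \is a fin_num -> (forall x, x \in S -> `|x| <= M) ->
  exists C L, [/\ all (fun k => 0 <= k.1) L, all (fun k => 0 <= k.2) L,
    forall x, `|x| <= M -> ((tent C L x)%:E <= phi x)%E &
    forall x, x \in S -> (tent C L x)%:E = phi x].
Proof.
move=> M0 SCphi phiM SM.
have [[cphi _ _] phi0 phiN] := SCphi.
have phin x : phi `|x| = phi x by case: (ger0P x) => // _; rewrite phiN.
have [|s [ps ls Ss]] := subdivision_through M [seq `|x| | x <- S] M0.
  by move=> x /mapP[y yS ->]; rewrite normr_ge0 SM.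
have [L [L1 L2 iL]] := SC0_tent_interpolation _ _ _ M0 SCphi phiM ps ls.
exists (fine (phi 0)), L; split => // x xS.
- rewrite -tent_norm -(phin x) -[leRHS]fineK ?lee_fin; last first.
    by apply: (SC0_fin _ _ _ SCphi phiM); rewrite normr_id.
  apply: (interpolates_le _ _ _ _ ps _ iL); last by rewrite ls normr_ge0.
  by rewrite ls; exact: SC0_chord_concave.
- rewrite -tent_norm -(phin x) -[RHS]fineK; last first.
    by apply: (SC0_fin _ _ _ SCphi phiM); rewrite normr_id SM.
  congr EFin; apply: (interpolates_eq _ _ _ _ ps iL).
  by apply: Ss; exact: map_f.
Qed.

(** A continuous piecewise linear function is only known to be affine on open
pieces; continuity carries the formula to the end points. *)
Lemma affine_closure (f : R -> R) (a b u v : R) : a < b ->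
  {within `[a, b], continuous f} ->
  (forall x, a < x < b -> f x = u * x + v) ->
  forall x, a <= x <= b -> f x = u * x + v.
Proof.
move=> ab /(continuous_within_itvP _ ab)[_ fa fb] fE x /andP[ax xb].
have cl : continuous (fun y => u * y + v).
  move=> y; apply: (@cvgD _ R); last exact: cvg_cst.
  by apply: (@cvgM R); [exact: cvg_cst|exact: cvg_id].
move: ax; rewrite le_eqVlt => /predU1P[<-|ax].
  rewrite -(cvg_lim (@Rhausdorff R) fa); apply: cvg_lim => //.
  apply: cvg_trans (cvg_at_right_filter (cl a)).
  apply: near_eq_cvg; near=> y; rewrite fE//; apply/andP; split => //.
move: xb; rewrite le_eqVlt => /predU1P[->|xb]; last by apply: fE; rewrite ax.
rewrite -(cvg_lim (@Rhausdorff R) fb); apply: cvg_lim => //.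
apply: cvg_trans (cvg_at_left_filter (cl b)).
apply: near_eq_cvg; near=> y; rewrite fE//; apply/andP; split => //.
Unshelve. all: by end_near. Qed.

Lemma piecewise_affine_of_continuous (f : R -> R) s (a : R) :
  path <%R a s -> {within `[a, last a s], continuous f} ->
  (forall i, (i < size s)%N -> exists u v : R, forall x,
     nth a (a :: s) i < x < nth a (a :: s) i.+1 -> f x = u * x + v) ->
  piecewise_affine f a s.
Proof.
elim: s a => //= c s ih a /andP[ac cs] cf fE.
have cl := path_le_last _ _ cs; split.
  have [u [v uv]] := fE 0 isT; exists u, v.
  apply: affine_closure => //; apply: continuous_subspaceW cf.
  by apply: subset_itvl; rewrite bnd_simp.
apply: ih => //.
  apply: continuous_subspaceW cf; apply: subset_itvr; rewrite bnd_simp.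
  exact: ltW.
move=> i iS; have [u [v uv]] := fE i.+1 iS; exists u, v => x xi.
apply: uv => /=; move: xi.
by rewrite (set_nth_default a) ?(set_nth_default a c)//= ltnS ltnW.
Qed.

End Tents.

(** * Kinks of a tent and knots *)

Section Knots.
Context {R : realType}.
Implicit Types (L : seq (R * R)) (C M s t u x y : R).

(** An even function is determined on [0, M], where a piecewise linear one
coincides with its interpolant at the break points. *)
Lemma tent_representation (psi : R -> \bar R) M : 0 < M -> classSC0 psi ->
  (forall x, - M <= x <= M -> psi x \is a fin_num) ->
  continuous_piecewise_linear (- M) M (fun x => fine (psi x)) ->
  (forall x, ~~ (- M <= x <= M) -> psi x = -oo%E) ->
  exists C L, [/\ all (fun k => 0 <= k.1) L, all (fun k => 0 <= k.2) L &
    psi = tent_log_density M C L].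
Proof.
move=> M0 SCpsi fin [cpsi [s0 [ps0 ls0 lin]]] out.
have NM0 : - M <= 0 by rewrite oppr_le0 ltW.
have finM : psi M \is a fin_num by rewrite fin// lexx andbT (le_trans NM0)// ltW.
have pa : piecewise_affine (fun x => fine (psi x)) (- M) s0.
  by apply: piecewise_affine_of_continuous => //; rewrite ls0.
have [|s [ps ls pas]] := piecewise_affine_from0 _ _ _ ps0 pa.
  by rewrite ls0 NM0 ltW.
rewrite ls0 in ls.
have [L [L1 L2 iL]] := SC0_tent_interpolation _ _ _ M0 SCpsi finM ps ls.
exists (fine (psi 0)), L; split => //; apply/funext => x.
rewrite /tent_log_density ler_norml; case: ifPn => [xM|/out//].
have [_ _ psiN] := SCpsi.
have -> : psi x = psi `|x| by case: (ger0P x) => // _; rewrite psiN.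
have aM : - M <= `|x| <= M.
  by rewrite (le_trans NM0)//= ler_norml.
rewrite -[LHS]fineK ?fin//; congr EFin.
rewrite -tent_norm; apply/esym.
apply: (interpolates_affine _ _ _ _ ps iL pas).
by rewrite ls normr_ge0; case/andP: aM.
Qed.

(** The left derivative at t >= 0 of the hinge with kink s >= 0.  At t = 0 the
absolute value contributes the slope -1 from the left when s = 0. *)
Definition left_slope t s : R := if t == 0 then - (s == 0)%R%:R else (s < t)%R%:R.

Lemma hinge_right_quotient s t : 0 <= t ->
  (hinge s (t + u) - hinge s t) / u @[u --> 0^'+] --> ((s <= t)%R%:R : R).
Proof.
move=> t0; apply: cvg_near_cst; have [st|ts] := leP s t; near=> u.
  have u0 : 0 < u by [].
  rewrite /hinge !ger0_norm//; last by rewrite addr_ge0// ltW.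
  rewrite !(max_idPr _) ?subr_ge0//; last lra.
  by rewrite /=; field; rewrite gt_eqF.
have u0 : 0 < u by [].
have us : u < s - t by near: u; apply: nbhs_right_lt; rewrite subr_gt0.
rewrite /hinge !ger0_norm//; last by rewrite addr_ge0// ltW.
rewrite !(max_idPl _) ?subr0 ?mul0r// subr_le0 ?ltW//.
by rewrite addrC -ltrBrDr.
Unshelve. all: by end_near. Qed.

Lemma hinge_left_quotient s t : 0 <= s -> 0 <= t ->
  (hinge s (t + u) - hinge s t) / u @[u --> 0^'-] --> left_slope t s.
Proof.
move=> s0 t0; apply: cvg_near_cst.
rewrite /left_slope; have [->|tn0] := eqVneq t 0.
  have s_le0 : Num.max 0 (- s) = 0 by rewrite (max_idPl _)// oppr_le0.
  have [->|sn0] := eqVneq s 0; near=> u; have u0 : u < 0 by [].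
    rewrite add0r /hinge normr0 !subr0 (ltr0_norm u0) maxxx subr0.
    by rewrite (max_idPr _) ?oppr_ge0 ?ltW// mulNr divff// lt_eqF.
  have us : - s < u.
    by near: u; apply: nbhs_left_gt; rewrite oppr_lt0 lt_neqAle eq_sym sn0.
  rewrite add0r /hinge normr0 sub0r (ltr0_norm u0) s_le0 subr0.
  by rewrite (max_idPl _) ?mul0r ?oppr0//; rewrite subr_le0 lerNl ltW.
have tgt0 : 0 < t by rewrite lt_neqAle eq_sym tn0.
have [st|ts] := ltP s t; near=> u; have u0 : u < 0 by [].
  have us : s - t < u by near: u; apply: nbhs_left_gt; rewrite subr_lt0.
  have tu0 : 0 < t + u by lra.
  rewrite /hinge (gtr0_norm tgt0) (gtr0_norm tu0).
  rewrite !(max_idPr _) ?subr_ge0 ?(ltW st)//; last lra.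
  by rewrite /=; field; rewrite lt_eqF.
have ut : - t < u by near: u; apply: nbhs_left_gt; rewrite oppr_lt0.
have tu0 : 0 < t + u by lra.
rewrite /hinge (gtr0_norm tgt0) (gtr0_norm tu0).
rewrite !(max_idPl _) ?subr0 ?mul0r// subr_le0//.
by rewrite (le_trans _ ts)// gerDl ltW.
Unshelve. all: by end_near. Qed.

Lemma tent_quotient (F : set_system R) {FF : ProperFilter F} C L t (D : R -> R) :
  (forall k, k \in L ->
    (hinge k.2 (t + u) - hinge k.2 t) / u @[u --> F] --> D k.2) ->
  (tent C L (t + u) - tent C L t) / u @[u --> F]
    --> - \sum_(k <- L) k.1 * D k.2.
Proof.
elim: L => [|[d s] L ih] kD.
  rewrite big_nil oppr0; apply: cvg_near_cst; apply: nearW => u.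
  by rewrite /tent !big_nil subrr mul0r.
have -> : - (\sum_(k <- (d, s) :: L) k.1 * D k.2) =
    - (\sum_(k <- L) k.1 * D k.2) - d * D s by rewrite big_cons /=; ring.
rewrite (_ : (fun u => _) = (fun u => (tent C L (t + u) - tent C L t) / u
    - d * ((hinge s (t + u) - hinge s t) / u))); last first.
  by apply/funext => u; rewrite !tent_cons; ring.
apply: (@cvgB _ R).
  by apply: ih => k kL; apply: kD; rewrite inE kL orbT.
apply: (@cvgM R); first exact: cvg_cst.
by have := kD (d, s); rewrite mem_head => /(_ isT).
Qed.

(** The jump of the derivative at t is the sum of the weights of the hinges with
kink t, doubled at t = 0 where the two branches of |x| meet.  The weights
being nonnegative, it vanishes only if each of these weights does. *)
Lemma tent_knotP (f : R -> R) M C L t :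
  (forall x, `|x| <= M -> f x = tent C L x) ->
  all (fun k => 0 <= k.1) L -> all (fun k => 0 <= k.2) L -> 0 <= t < M ->
  knots (- M) M f t <-> exists k, [/\ k \in L, 0 < k.1 & k.2 = t].
Proof.
move=> fE L1 L2 /andP[t0 tM]; have M0 := le_lt_trans t0 tM.
have ft : f t = tent C L t by rewrite fE// ger0_norm// ltW.
have rd : right_derivative f t = - \sum_(k <- L) k.1 * (k.2 <= t)%R%:R.
  apply/cvg_lim => //.
  apply: cvg_trans (@tent_quotient 0^'+ _ C L t (fun s => (s <= t)%R%:R) _); last first.
    by move=> k kL; exact: hinge_right_quotient.
  apply: near_eq_cvg; near=> u; rewrite ft fE//.
  have u0 : 0 < u by [].
  have ut : u < M - t by near: u; apply: nbhs_right_lt; rewrite subr_gt0.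
  rewrite ger0_norm ?(addr_ge0 t0 (ltW u0))//.
  lra.
have ld : left_derivative f t = - \sum_(k <- L) k.1 * left_slope t k.2.
  apply/cvg_lim => //.
  apply: cvg_trans (@tent_quotient 0^'- _ C L t (left_slope t) _); last first.
    by move=> k kL; apply: hinge_left_quotient => //; exact: (allP L2).
  apply: near_eq_cvg; near=> v; rewrite ft fE//.
  have u0 : v < 0 by [].
  have ut : - M < v by near: v; apply: nbhs_left_gt; rewrite oppr_lt0.
  by rewrite ler_norml; apply/andP; split; lra.
have gap : left_derivative f t - right_derivative f t =
    (1 + (t == 0)%R%:R) * \sum_(k <- L) k.1 * (k.2 == t)%R%:R.
  rewrite ld rd opprK addrC -sumrB big_distrr /= [LHS]big_seq [RHS]big_seq.
  apply: eq_bigr => k kL; have k2 := allP L2 _ kL; rewrite -mulrBr mulrCA.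
  congr (_ * _); rewrite /left_slope; have [->|tn0] := eqVneq t 0.
    have -> : (k.2 <= 0) = (k.2 == 0) by rewrite eq_le k2 andbT.
    by rewrite ?eqxx /=; ring.
  by case: (ltgtP k.2 t) => _ /=; ring.
have gt0 : 1 + (t == 0)%R%:R != 0 :> R by case: (t == 0); rewrite /= ?addr0 ?oner_eq0// gt_eqF.
have S0 : (\sum_(k <- L) k.1 * (k.2 == t)%R%:R == 0) =
    all (fun k : R * R => k.1 * (k.2 == t)%R%:R == 0) L.
  rewrite big_seq psumr_eq0.
    by apply: eq_in_all => k ->.
  by move=> k kL; rewrite mulr_ge0 ?ler0n//; exact: (allP L1).
split.
- case=> [[_ /eqP]|[tE|tE]]; last 2 first.
  + by move: t0; rewrite tE; lra.
  + by move: tM; rewrite tE ltxx.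
  rewrite -subr_eq0 gap mulf_eq0 negb_or gt0 /= S0 => /allPn[k kL].
  rewrite mulf_eq0 negb_or => /andP[k0]; rewrite pnatr_eq0 eqb0 negbK => /eqP kt.
  by exists k; split => //; rewrite lt_neqAle eq_sym k0; exact: (allP L1).
- move=> [k [kL k0 kt]]; left; split; first by apply/andP; split => //; lra.
  apply/eqP; rewrite -subr_eq0 gap mulf_eq0 negb_or gt0 /= S0.
  by apply/allPn; exists k => //; rewrite kt eqxx mulr1 gt_eqF.
Unshelve. all: by end_near. Qed.

End Knots.

(** * Integrals of hinges and a bound on the exponential *)

Section Integrals.
Context {R : realType}.
Local Notation mu := (@lebesgue_measure R).
Implicit Types (f g q v : R -> R) (M t x y : R).

Lemma even_integral f M : 0 <= M -> continuous f -> (forall x, 0 <= f x) ->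
  (forall x, f (- x) = f x) ->
  (\int[mu]_(x in `[(- M)%R, M]) (f x)%:E =
   \int[mu]_(x in `[0%R, M]) (2 * f x)%:E)%E.
Proof.
move=> M0 cf f0 fN.
have mf D : measurable_fun D (fun x => (f x)%:E).
  by apply/measurable_EFinP/measurable_funTS; exact: continuous_measurable_fun.
have NM0 : - M <= 0 by rewrite oppr_le0.
have -> : `[- M, M]%classic = `[- M, 0[%classic `|` `[0, M]%classic.
  by rewrite -itv_bndbnd_setU ?bnd_simp.
rewrite ge0_integral_setU//=; last 3 first.
- exact: mf.
- by move=> x _; rewrite lee_fin.
- apply/disj_setPRL => x /=; rewrite !in_itv /= => /andP[x0 _].
  by apply/negP; rewrite ltNge x0 andbF.
rewrite integral_itv_bndo_bndc; last exact: mf.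
rewrite -[X in BRight X]oppr0 integration_by_substitution_oppr//; last first.
  exact: continuous_subspaceT.
under eq_integral do rewrite /= fN.
under [RHS]eq_integral do rewrite EFinM.
rewrite ge0_integralZl_EFin//; [|by move=> x _; rewrite lee_fin|exact: mf].
by rewrite mule_natl mule2n.
Qed.

(** For fixed y in [t, M], the x with t <= x <= y form an interval of length
y - t = h_t(y); exchanging the integrals leaves int_t^M 2 h_t g, and evenness
turns the factor 2 into an integral over [-M, M]. *)
Lemma iterated_integral_hinge g M t : continuous g -> (forall x, 0 <= g x) ->
  (forall x, g (- x) = g x) -> 0 <= t <= M ->
  (\int[mu]_(x in `[t, M]) \int[mu]_(y in `[x, M]) (2 * g y)%:E =
   \int[mu]_(y in `[(- M)%R, M]) (hinge t y * g y)%:E)%E.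
Proof.
move=> cg g0 gN /andP[t0 tM]; have M0 := le_trans t0 tM.
have mg : measurable_fun setT g by exact: continuous_measurable_fun.
pose F (z : R * R) : \bar R :=
  if [&& t <= z.1, z.1 <= z.2 & z.2 <= M] then (2 * g z.2)%:E else 0%E.
have mF : measurable_fun setT F.
  have m1 : measurable_fun setT (fun z : R * R => t <= z.1).
    by apply: (measurable_fun_ler (measurable_cst _)) => //; exact: measurable_fst.
  have m2 : measurable_fun setT (fun z : R * R => z.1 <= z.2).
    by apply: (measurable_fun_ler measurable_fst) => //; exact: measurable_snd.
  have m3 : measurable_fun setT (fun z : R * R => z.2 <= M).
    by apply: (measurable_fun_ler measurable_snd) => //; exact: measurable_cst.
  apply: measurable_fun_ifT.
  - exact: (measurable_and m1 (measurable_and m2 m3)).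
  - apply/measurable_EFinP; apply: measurable_funM; first exact: measurable_cst.
    by apply: measurableT_comp.
  - exact: measurable_cst.
have F0 z : (0 <= F z)%E.
  by rewrite /F; case: ifP => // _; rewrite lee_fin mulr_ge0.
transitivity (\int[mu]_x \int[mu]_y F (x, y))%E.
  rewrite integral_mkcond; apply: eq_integral => x _.
  rewrite patchE mem_setE in_itv /=.
  case: ifPn => [/andP[tx xM]|xtM].
    rewrite integral_mkcond; apply: eq_integral => y _.
    by rewrite patchE mem_setE in_itv /= /F /= tx.
  rewrite integral0_eq// => y _; rewrite /F /=.
  case: ifPn => // /and3P[tx xy yM]; move: xtM.
  by rewrite tx (le_trans xy yM).
rewrite (@fubini_tonelli _ _ _ _ _ mu mu F mF F0).
transitivity (\int[mu]_(y in `[t, M]) (2 * g y * (y - t))%:E)%E.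
  rewrite [RHS]integral_mkcond; apply: eq_integral => y _.
  rewrite patchE mem_setE in_itv /=.
  case: ifPn => [/andP[ty yM]|ytM].
    transitivity (\int[mu]_(x in `[t, y]) cst (2 * g y)%:E x)%E.
      rewrite [RHS]integral_mkcond; apply: eq_integral => x _.
      by rewrite patchE mem_setE in_itv /= /F /= yM andbT.
    rewrite integral_cst//= lebesgue_measure_itv /= lte_fin EFinM.
    by move: ty; rewrite le_eqVlt => /predU1P[->|->]; rewrite ?ltxx ?subrr.
  rewrite integral0_eq// => x _; rewrite /F /=.
  case: ifPn => // /and3P[tx xy yM]; move: ytM.
  by rewrite yM (le_trans tx xy).
have ch : continuous (fun y => hinge t y * g y).
  by move=> y; apply: (@cvgM R); [exact: hinge_continuous|exact: cg].
rewrite even_integral//; last 2 first.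
- by move=> x; rewrite mulr_ge0// hinge_ge0.
- by move=> x; rewrite hingeN gN.
rewrite integral_mkcond [RHS]integral_mkcond; apply: eq_integral => y _.
rewrite !patchE !mem_setE !in_itv /=.
have [ty|yt] := leP t y.
  rewrite (le_trans t0 ty) /=; case: ifP => // _; congr EFin.
  by rewrite /hinge ger0_norm ?(le_trans t0 ty)// (max_idPr _) ?subr_ge0//; ring.
case: ifP => //= /andP[y0 yM].
by rewrite /hinge ger0_norm// (max_idPl _) ?mul0r ?mulr0// subr_le0 ltW.
Qed.

Lemma continuous_integrable_itv f (a b : R) : continuous f ->
  mu.-integrable `[a, b] (EFin \o f).
Proof.
move=> cf; apply: continuous_compact_integrable; first exact: segment_compact.
exact: continuous_subspaceT.
Qed.

Lemma integral_tail_count M t (o : R) : 0 <= t -> t <= M -> 0 <= o <= M ->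
  (\int[mu]_(x in `[t, M]) ((x <= o)%R%:R : R)%:E = (hinge t o)%:E)%E.
Proof.
move=> t0 tM /andP[oge0 oM].
transitivity (\int[mu]_(x in `[t, M]) (\1_(`]-oo, o]%classic) x)%:E)%E.
  by apply: eq_integral => x _; rewrite indicE mem_setE in_itv.
rewrite integral_indic//.
rewrite (_ : _ `&` _ = `[t, o]%classic); last first.
  apply/seteqP; split => x /=; rewrite !in_itv /=.
    by move=> [xo /andP[-> _]].
  by move=> /andP[-> xo]; rewrite xo (le_trans xo oM).
rewrite [LHS]lebesgue_measure_itv /= lte_fin /hinge ger0_norm//.
have [to|ot] := ltP t o; first by rewrite (max_idPr _)// subr_ge0 ltW.
by rewrite (max_idPl _)// subr_le0.
Qed.

(** exp u <= 1 / (1 - u) follows from 1 - u <= exp (- u), and the remainder is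
(1 - u) (1 + u + 2 u^2) - 1 = u^2 (1 - 2 u). *)
Lemma expR_le_quadratic (u : R) : u <= 1 / 2 -> expR u <= 1 + u + 2 * u ^+ 2.
Proof.
move=> u12; have u1 : 0 < 1 - u by lra.
rewrite -[u]opprK expRN opprK -[leRHS]mul1r.
apply: le_trans (_ : (1 - u)^-1 <= _).
  by rewrite lef_pV2 ?posrE ?expR_gt0// expR_ge1Dx.
rewrite mul1r -div1r ler_pdivrMr//.
nra.
Qed.

End Integrals.

(** * Optimality conditions among tents *)

Section FirstOrderConditions.
Context {R : realType} {n : nat} (X : 'I_n -> R) (M : R).
Local Notation mu := (@lebesgue_measure R).
Local Notation I f := (\int[mu]_(x in `[- M, M]) f x).
Hypotheses (n_gt0 : (0 < n)%N) (M_gt0 : 0 < M).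
Implicit Types (f q v : R -> R) (C t : R) (L : seq (R * R)).

Definition sample_mean f : R := n%:R^-1 * \sum_(i < n) f (X i).

(** The criterion of the log-density that is the tent on [-M, M] and -oo
outside. *)
Definition tent_objective C L : R :=
  sample_mean (tent C L) - I (fun x => expR (tent C L x)).

Let n_neq0 : n%:R != 0 :> R. Proof. by rewrite pnatr_eq0 -lt0n. Qed.

Let cint f : continuous f -> mu.-integrable `[- M, M] (EFin \o f).
Proof. exact: continuous_integrable_itv. Qed.

Let cM f q : continuous f -> continuous q -> continuous (fun x => f x * q x).
Proof. by move=> cf cq x; apply: (@cvgM R); [exact: cf|exact: cq]. Qed.

Let cZ (a : R) f : continuous f -> continuous (fun x => a * f x).
Proof. by move=> cf x; apply: (@cvgM R); [exact: cvg_cst|exact: cf]. Qed.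

Let cD f q : continuous f -> continuous q -> continuous (fun x => f x + q x).
Proof. by move=> cf cq x; apply: (@cvgD _ R); [exact: cf|exact: cq]. Qed.

Let cN f : continuous f -> continuous (fun x => - f x).
Proof. by move=> cf x; apply: (@cvgN _ R); exact: cf. Qed.

Let cE f : continuous f -> continuous (fun x => expR (f x)).
Proof. by move=> cf x; apply: continuous_comp; [exact: cf|exact: continuous_expR]. Qed.

Lemma sample_mean_tent C L : sample_mean (tent C L) =
  C - \sum_(k <- L) k.1 * sample_mean (hinge k.2).
Proof.
rewrite /sample_mean; elim: L => [|[d s] L ih].
  rewrite big_nil subr0 (eq_bigr (fun=> C)); last first.
    by move=> i _; rewrite /tent big_nil subr0.
  by rewrite sumr_const card_ord -[C *+ n]mulr_natl mulKf.
rewrite big_cons /= (eq_bigr (fun i => tent C L (X i) - d * hinge s (X i))).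
  by rewrite sumrB -mulr_sumr mulrBr ih; ring.
by move=> i _; rewrite tent_cons.
Qed.

Lemma integral_tent_mul q C L : continuous q ->
  I (fun x => tent C L x * q x) =
  C * I q - \sum_(k <- L) k.1 * I (fun x => hinge k.2 x * q x).
Proof.
move=> cq; elim: L => [|[d s] L ih].
  rewrite big_nil subr0 -RintegralZl//; last exact: cint.
  by apply: eq_Rintegral => x _; rewrite /tent big_nil subr0.
have ch : continuous (fun x => hinge s x * q x).
  by apply: cM => //; exact: hinge_continuous.
have ct : continuous (fun x => tent C L x * q x).
  by apply: cM => //; exact: tent_continuous.
rewrite big_cons /=.
transitivity (I (fun x => tent C L x * q x - d * (hinge s x * q x))).
  by apply: eq_Rintegral => x _; rewrite tent_cons; ring.
rewrite RintegralB//; [|exact: cint|by apply: cint; exact: cZ].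
by rewrite RintegralZl ?ih//; [ring|exact: cint].
Qed.

(** The first-order conditions suffice because exp is convex. *)
Lemma tent_objective_max C L : I (fun x => expR (tent C L x)) = 1 ->
  let gap t := sample_mean (hinge t) -
               I (fun x => hinge t x * expR (tent C L x)) in
  (forall t, 0 <= t -> 0 <= gap t) ->
  (forall k, k \in L -> k.1 * gap k.2 = 0) ->
  forall C' L', all (fun k => 0 <= k.1) L' -> all (fun k => 0 <= k.2) L' ->
  tent_objective C' L' <= tent_objective C L.
Proof.
set q := fun x => expR (tent C L x) => I1 gap gap0 gapL C' L' L1 L2.
have ct C0 L0 := @tent_continuous R C0 L0.
have cq : continuous q by exact: cE.
have lin C0 L0 : sample_mean (tent C0 L0) - I (fun x => tent C0 L0 x * q x) =
    - \sum_(k <- L0) k.1 * gap k.2.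
  rewrite sample_mean_tent integral_tent_mul// I1 mulr1.
  under [in RHS]eq_bigr do rewrite /gap mulrBr.
  by rewrite sumrB; ring.
have convex : 1 + (I (fun x => tent C' L' x * q x) - I (fun x => tent C L x * q x))
    <= I (fun x => expR (tent C' L' x)).
  rewrite -I1 -RintegralB//; [|exact/cint/cM|exact/cint/cM].
  have cB : continuous (fun x => tent C' L' x * q x - tent C L x * q x).
    by apply: cD; [exact: cM|apply: cN; exact: cM].
  rewrite -RintegralD//; [|exact: cint|exact: cint].
  apply: le_Rintegral => //; [by apply: cint; exact: cD|exact/cint/cE|].
  move=> x _; have := ler_wpM2r (expR_ge0 (tent C L x))
    (expR_ge1Dx (tent C' L' x - tent C L x)).
  by rewrite -expRD subrK mulrDl mul1r mulrBl.
have lin' := lin C' L'; have linL := lin C L.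
have S0 : \sum_(k <- L) k.1 * gap k.2 = 0 by rewrite big_seq big1.
rewrite S0 oppr0 in linL.
have : 0 <= \sum_(k <- L') k.1 * gap k.2.
  rewrite big_seq sumr_ge0// => k kL.
  by rewrite mulr_ge0 ?gap0//; [exact: (allP L1)|exact: (allP L2)].
rewrite /tent_objective -/q I1; lra.
Qed.

Lemma integral_expR_perturb q v (K e : R) : continuous q -> continuous v ->
  (forall x, 0 <= q x) -> I q = 1 ->
  (forall x, `|x| <= M -> `|v x| <= K) -> 0 < e -> e * K <= 1 / 2 ->
  I (fun x => q x * expR (e * v x)) <=
  1 + e * I (fun x => v x * q x) + 2 * (e * K) ^+ 2.
Proof.
move=> cq cv q0 I1 vK e0 eK.
have cvq : continuous (fun x => v x * q x) by exact: cM.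
have -> : 1 + e * I (fun x => v x * q x) + 2 * (e * K) ^+ 2 =
    I (fun x => q x + e * (v x * q x) + 2 * (e * K) ^+ 2 * q x).
  rewrite RintegralD//; [|by apply: cint; apply: cD => //; exact: cZ|exact/cint/cZ].
  rewrite RintegralD//; [|exact/cint|exact/cint/cZ].
  rewrite !RintegralZl//; [|exact/cint|exact/cint].
  by rewrite I1 mulr1.
apply: le_Rintegral => //.
- by apply: cint; apply: cM => //; apply: cE; exact: cZ.
- by apply: cint; apply: cD; [apply: cD => //; exact: cZ|exact: cZ].
move=> x /=; rewrite in_itv /= -ler_norml => xM.
have /ler_normlP[v1 v2] := vK x xM.
have evK : e * v x <= e * K by rewrite ler_pM2l.
have NevK : - (e * v x) <= e * K by rewrite -mulrN ler_pM2l.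
have := expR_le_quadratic _ (le_trans evK eK).
have sq : (e * v x) ^+ 2 <= (e * K) ^+ 2.
  by rewrite -real_normK ?num_real// lerXn2r ?nnegrE ?normr_ge0 ?ler_norml//; lra.
move=> quad; have : expR (e * v x) <= 1 + e * v x + 2 * (e * K) ^+ 2 by lra.
move=> /(ler_wpM2l (q0 x)) /le_trans; apply.
by rewrite le_eqVlt; apply/orP; left; apply/eqP; ring.
Qed.

(** If moving along v for every small step does not improve the criterion, then
its derivative along v is nonpositive.  The second-order term 2 (e K)^2 of the
expansion is beaten by taking e below a / (4 K^2), where a would be a positive
derivative. *)
Lemma first_order_condition q v (K e0 : R) : continuous q -> continuous v ->
  (forall x, 0 <= q x) -> I q = 1 -> 0 < K ->
  (forall x, `|x| <= M -> `|v x| <= K) -> 0 < e0 ->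
  (forall e, 0 < e -> e <= e0 ->
     e * sample_mean v <= I (fun x => q x * expR (e * v x)) - 1) ->
  sample_mean v <= I (fun x => v x * q x).
Proof.
move=> cq cv q0 I1 K0 vK e00 opt; rewrite leNgt; apply/negP => gt.
set a := sample_mean v - I (fun x => v x * q x).
have a0 : 0 < a by rewrite subr_gt0.
have KK0 : 0 < 4 * K ^+ 2 by rewrite mulr_gt0// exprn_gt0.
have h1 : 0 < a / (4 * K ^+ 2) by rewrite divr_gt0.
have h2 : 0 < (2 * K)^-1 by rewrite invr_gt0 mulr_gt0.
(* small enough to be feasible, to beat the quadratic remainder, and to stay in
   the range where the quadratic bound on exp is valid *)
pose e := Num.min e0 (Num.min (a / (4 * K ^+ 2)) (2 * K)^-1).
have e_gt0 : 0 < e by rewrite !lt_min e00 h1.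
have e1 : e <= e0 by rewrite ge_min lexx.
have e2 : e <= a / (4 * K ^+ 2) by rewrite !ge_min lexx orbT.
have e3 : e <= (2 * K)^-1 by rewrite !ge_min lexx !orbT.
have eK : e * K <= 1 / 2.
  apply: le_trans (ler_wpM2r (ltW K0) e3) _.
  by rewrite le_eqVlt; apply/orP; left; apply/eqP; field; rewrite gt_eqF.
have := opt e e_gt0 e1.
have := integral_expR_perturb q v K e cq cv q0 I1 vK e_gt0 eK.
rewrite ler_pdivlMr// in e2.
have ea : e * (e * (4 * K ^+ 2)) <= e * a by rewrite ler_pM2l.
have : 0 < e * a by rewrite mulr_gt0.
rewrite /a in ea *; nra.
Qed.

(** The direction -h_t is always feasible; the direction h_t is feasible for
steps up to the weight of h_t in the tent, by lowering that weight. *)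
Lemma tent_objective_necessary C L :
  all (fun k => 0 <= k.1) L -> all (fun k => 0 <= k.2) L ->
  I (fun x => expR (tent C L x)) = 1 ->
  (forall L', all (fun k => 0 <= k.1) L' -> all (fun k => 0 <= k.2) L' ->
     tent_objective C L' <= tent_objective C L) ->
  let gap t := sample_mean (hinge t) -
               I (fun x => hinge t x * expR (tent C L x)) in
  (forall t, 0 <= t -> 0 <= gap t) /\
  (forall k, k \in L -> 0 < k.1 -> gap k.2 = 0).
Proof.
set q := fun x => expR (tent C L x) => L1 L2 I1 opt gap.
have ct := @tent_continuous R C L.
have cq : continuous q by exact: cE.
have ch t := @hinge_continuous R t.
have q0 x : 0 <= q x by exact: expR_ge0.
have perturb v e : (exists L', [/\ all (fun k => 0 <= k.1) L',
    all (fun k => 0 <= k.2) L' & forall x, tent C L' x = tent C L x + e * v x]) ->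
    e * sample_mean v <= I (fun x => q x * expR (e * v x)) - 1.
  move=> [L' [L1' L2' E]]; have := opt _ L1' L2'.
  rewrite /tent_objective -/q I1.
  have -> : sample_mean (tent C L') = sample_mean (tent C L) + e * sample_mean v.
    rewrite /sample_mean (eq_bigr _ (fun i _ => E (X i))) big_split /=.
    by rewrite -mulr_sumr; ring.
  have -> : I (fun x => expR (tent C L' x)) = I (fun x => q x * expR (e * v x)).
    by apply: eq_Rintegral => x _; rewrite E expRD.
  lra.
have hM t x : 0 <= t -> `|x| <= M -> `|hinge t x| <= M.
  by move=> t0 xM; rewrite ger0_norm ?hinge_ge0// hinge_le.
have gap_ge0 t : 0 <= t -> 0 <= gap t.
  move=> t0.
  have : sample_mean (fun x => - hinge t x) <= I (fun x => - hinge t x * q x).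
    apply: (@first_order_condition q _ M 1) => //.
    - exact: cN.
    - by move=> x xM; rewrite normrN hM.
    - move=> e e0 _; apply: perturb; exists ((e, t) :: L).
      rewrite /= (ltW e0) t0 L1 L2; split => // x.
      by rewrite tent_cons; ring.
  have -> : sample_mean (fun x => - hinge t x) = - sample_mean (hinge t).
    by rewrite /sample_mean sumrN mulrN.
  have -> : I (fun x => - hinge t x * q x) = - I (fun x => hinge t x * q x).
    rewrite -[RHS]mulN1r -RintegralZl//; last exact/cint/cM.
    by apply: eq_Rintegral => x _; ring.
  by rewrite lerN2 subr_ge0.
split => // k kL k0; have k2 := allP L2 _ kL.
apply/eqP; rewrite eq_le gap_ge0// andbT subr_le0.
apply: (@first_order_condition q _ M k.1) => //.
  by move=> x; exact: hM.
move=> e e0 ek; apply: perturb.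
(* the weight of one occurrence of the kink is lowered by e *)
exists ((k.1 - e, k.2) :: rem k L); split => /=.
- rewrite subr_ge0 ek; apply/allP => j /mem_rem; exact: (allP L1).
- rewrite k2; apply/allP => j /mem_rem; exact: (allP L2).
- move=> x; rewrite tent_cons.
  have -> : tent C L x = tent C (k :: rem k L) x.
    by rewrite /tent (perm_big _ (perm_to_rem kL)).
  by case: k {kL k0 k2 ek} => d s; rewrite tent_cons /=; ring.
Qed.

End FirstOrderConditions.

(** * The sample and the criterion *)

Section OrderStatistics.
Context {R : realType} {n : nat} (n_gt0 : (0 < n)%N) (X : 'I_n -> R).

Let s := sort <=%R [seq `|X j| | j <- enum 'I_n].
Let size_s : size s = n.
Proof. by rewrite size_sort size_map size_enum_ord. Qed.

Lemma norm_le_abs_max i : `|X i| <= abs_max X.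
Proof.
have : `|X i| \in s by rewrite mem_sort; apply/mapP; exists i; rewrite ?mem_enum.
move=> /(nthP 0)[k ks <-]; rewrite size_s in ks.
apply: (sorted_leq_nth le_trans le_refl); rewrite ?inE ?size_s ?prednK//.
  by apply: sort_sorted; exact: le_total.
by rewrite -ltnS prednK.
Qed.

Lemma abs_os_norm k : (k < n)%N -> exists i, abs_os X k = `|X i|.
Proof.
move=> kn; have : abs_os X k \in s by rewrite mem_nth// size_s.
by rewrite mem_sort => /mapP[i _ ->]; exists i.
Qed.

Lemma abs_os_itv (k : 'I_n) : 0 <= abs_os X k <= abs_max X.
Proof.
by have [i ->] := abs_os_norm _ (ltn_ord k); rewrite normr_ge0 norm_le_abs_max.
Qed.

Lemma abs_max_attained : exists i, abs_max X = `|X i|.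
Proof. by apply: abs_os_norm; rewrite prednK. Qed.

Lemma sum_abs_os (f : R -> R) :
  \sum_(i < n) f (abs_os X i) = \sum_(i < n) f `|X i|.
Proof.
transitivity (\sum_(x <- s) f x).
  by rewrite (big_nth 0) size_s big_mkord.
rewrite (perm_big _ (introT permPl (perm_sort _ _))) big_map.
by rewrite big_enum.
Qed.

End OrderStatistics.

Section Criterion.
Context {R : realType} {n : nat} (n_gt0 : (0 < n)%N) (X : 'I_n -> R).
Local Notation mu := (@lebesgue_measure R).
Local Notation M := (abs_max X).
Hypothesis M_gt0 : 0 < M.
Implicit Types (phi : R -> \bar R) (C t : R) (L : seq (R * R)).

(** This holds for arbitrary nonnegative functions, because their integral is the
supremum of the integrals of the simple functions below them. *)
Lemma le_integral_nonneg (f g : R -> \bar R) : (forall x, 0 <= f x)%E ->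
  (forall x, f x <= g x)%E -> (\int[mu]_x f x <= \int[mu]_x g x)%E.
Proof.
move=> f0 fg; have g0 x : (0 <= g x)%E by exact: le_trans (fg x).
rewrite !ge0_integralTE//; apply: ereal_sup_le => _ [h hf <-].
by exists h => // x; exact: le_trans (fg x).
Qed.

Lemma integral_expR_tent C L :
  (\int[mu]_x expeR (tent_log_density M C L x) =
   (\int[mu]_(x in `[- M, M]) expR (tent C L x))%:E)%E.
Proof.
have ce : continuous (fun x : R => expR (tent C L x)).
  by move=> x; apply: continuous_comp; [exact: tent_continuous|exact: continuous_expR].
rewrite /Rintegral fineK; last first.
  by apply: integrable_fin_num => //; exact: continuous_integrable_itv.
rewrite [RHS]integral_mkcond; apply: eq_integral => x _.
by rewrite patchE mem_setE in_itv /= -ler_norml /tent_log_density; case: ifP.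
Qed.

Lemma criterion_tent C L :
  criterion X (tent_log_density M C L) = (tent_objective X M C L)%:E.
Proof.
rewrite /criterion integral_expR_tent (eq_bigr (fun i => (tent C L (X i))%:E)).
  by rewrite sumEFin -EFinM -EFinB.
by move=> i _; rewrite /tent_log_density norm_le_abs_max.
Qed.

(** Replacing phi by its interpolating tent keeps the values at the observations
and lowers the integral.  If phi is -oo at an observation its criterion is -oo
and any tent will do. *)
Lemma criterion_le_tent phi : classSC0 phi ->
  exists C L, [/\ all (fun k => 0 <= k.1) L, all (fun k => 0 <= k.2) L &
    (criterion X phi <= (tent_objective X M C L)%:E)%E].
Proof.
move=> SCphi; have [[_ _ [phiy _]] _ phiN] := SCphi.
have ninv : 0 < n%:R^-1 :> R by rewrite invr_gt0 ltr0n.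
have [/existsP[i /eqP phii]|nophi] := boolP [exists i, phi (X i) == -oo%E].
  exists 0, [::]; split => //; rewrite /criterion.
  have -> : \sum_(i < n) phi (X i) = -oo%E by apply/esum_eqNyP; exists i.
  by rewrite gt0_muleNy ?lte_fin// addNye leNye.
have fin i : phi (X i) \is a fin_num.
  rewrite fin_numE (lt_eqF (phiy _)) andbT; move: nophi.
  by rewrite negb_exists => /forallP.
have finM : phi M \is a fin_num.
  have [i ->] := abs_max_attained n_gt0 X.
  by case: (ger0P (X i)) => _; rewrite ?phiN.
have XM i : `|X i| <= M by exact: norm_le_abs_max.
have [|C [L [L1 L2 le eqX]]] :=
    SC0_tent_minorant phi M [seq X i | i <- enum 'I_n] M_gt0 SCphi finM.
  by move=> x /mapP[i _ ->].
exists C, L; split => //; rewrite -criterion_tent /criterion.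
apply: leeB; last first.
  apply: le_integral_nonneg => x; first exact: expeR_ge0.
  by rewrite lee_expeR /tent_log_density; case: ifP => [/le//|]; rewrite leNye.
rewrite le_eqVlt; apply/orP; left; apply/eqP; congr (_ * _)%E.
apply: eq_bigr => i _; rewrite /tent_log_density XM eqX//.
by rewrite map_f// mem_enum.
Qed.

Lemma is_MLE_tentP C L :
  all (fun k => 0 <= k.1) L -> all (fun k => 0 <= k.2) L ->
  is_MLE_SLC0 X (fun x => expeR (tent_log_density M C L x)) <->
  forall C' L', all (fun k => 0 <= k.1) L' -> all (fun k => 0 <= k.2) L' ->
    tent_objective X M C' L' <= tent_objective X M C L.
Proof.
move=> L1 L2; split.
- move=> [psi [_ opt E]] C' L' L1' L2'.
  rewrite -lee_fin -!criterion_tent.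
  rewrite (_ : tent_log_density M C L = psi).
    by apply: opt; exact: tent_log_density_SC0.
  by apply/funext => x; apply: expeR_inj; move/(congr1 (fun f => f x)): E.
- move=> opt; exists (tent_log_density M C L); split => //.
    exact: tent_log_density_SC0.
  move=> phi /criterion_le_tent[C' [L' [L1' L2' /le_trans]]]; apply.
  by rewrite criterion_tent lee_fin opt.
Qed.

Lemma integral_Ghat C L t : 0 <= t <= M ->
  (\int[mu]_(x in `[t, M]) Ghat_plus_R X (tent_log_density M C L) x =
   (\int[mu]_(x in `[- M, M]) (hinge t x * expR (tent C L x)))%:E)%E.
Proof.
move=> tM; have /andP[t0 _] := tM.
have ce : continuous (fun x : R => expR (tent C L x)).
  by move=> x; apply: continuous_comp; [exact: tent_continuous|exact: continuous_expR].
have che : continuous (fun x : R => hinge t x * expR (tent C L x)).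
  by move=> x; apply: (@cvgM R); [exact: hinge_continuous|exact: ce].
rewrite /Rintegral fineK; last first.
  by apply: integrable_fin_num => //; exact: continuous_integrable_itv.
rewrite -iterated_integral_hinge//; last first.
  by move=> x; rewrite tentN.
apply: eq_integral => x; rewrite inE /= in_itv /= => /andP[tx xM].
apply: eq_integral => y; rewrite inE /= in_itv /= => /andP[xy yM].
rewrite /ghat_plus /tent_log_density ger0_norm ?yM ?EFinM//.
exact: le_trans (le_trans t0 tx) xy.
Qed.

Lemma integral_Fn t : 0 <= t <= M ->
  (\int[mu]_(x in `[t, M]) (Fn_plus_R X x)%:E = (sample_mean X (hinge t))%:E)%E.
Proof.
move=> /andP[t0 tM]; rewrite /Fn_plus_R.
have mF (i : 'I_n) : measurable_fun `[t, M]
    (fun x : R => ((x <= abs_os X i)%R%:R : R)%:E).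
  apply/measurable_EFinP.
  rewrite (_ : (fun _ => _) = \1_(`]-oo, abs_os X i]%classic)).
    exact: measurable_indic.
  by apply/funext => x; rewrite indicE mem_setE in_itv.
under eq_integral do rewrite EFinM -sumEFin.
rewrite ge0_integralZl_EFin ?invr_ge0//; last 2 first.
- by move=> x _; apply: sume_ge0 => i _; rewrite lee_fin.
- by apply: emeasurable_sum.
rewrite ge0_integral_sum//.
rewrite (eq_bigr (fun i : 'I_n => (hinge t (abs_os X i))%:E)); last first.
  by move=> i _; apply: integral_tail_count => //; exact: abs_os_itv.
rewrite sumEFin -EFinM sum_abs_os.
by under eq_bigr do rewrite hinge_norm.
Qed.

End Criterion.

(** * The characterization *)

(** If M were 0, exp psi would live on a single point and have integral 0. *)
Lemma abs_max_gt0 (R : realType) (n : nat) (n_gt0 : (0 < n)%N) (X : 'I_n -> R)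
    (psi : R -> \bar R) :
  (\int[lebesgue_measure]_x expeR (psi x) = 1)%E ->
  (forall x, ~~ (- abs_max X <= x <= abs_max X) -> psi x = -oo%E) ->
  0 < abs_max X.
Proof.
move=> I1 out; have [i Mi] := abs_max_attained n_gt0 X.
rewrite lt_neqAle Mi normr_ge0 andbT; apply/eqP => M0.
suff : (\int[lebesgue_measure]_x expeR (psi x) = 0)%E.
  by rewrite I1 => /eqP; rewrite onee_eq0.
rewrite -(integral_set1 (fun x => expeR (psi x)) 0) [RHS]integral_mkcond.
apply: eq_integral => x _; rewrite patchE; case: ifPn => // x0.
rewrite out// Mi -M0 oppr0 -eq_le; apply: contra x0 => /eqP <-.
by rewrite inE.
Qed.

Theorem theorem2p4 (R : realType) (n : nat) (n_gt0 : (0 < n)%N)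
  (X : 'I_n -> R)
  (X_strict : forall i j : 'I_n, (i < j)%N -> abs_os X i < abs_os X j)
  (psi : R -> \bar R)
  (psi_SLC0 : classSLC0 (fun x => expeR (psi x)))
  (psi_fin : forall x, - abs_max X <= x <= abs_max X -> psi x \is a fin_num)
  (psi_pl : continuous_piecewise_linear (- abs_max X) (abs_max X)
              (fun x => fine (psi x)))
  (psi_knots : knots (- abs_max X) (abs_max X) (fun x => fine (psi x))
                 `<=` admissible_knots X)
  (psi_out : forall x, ~~ (- abs_max X <= x <= abs_max X) -> psi x = -oo%E) :
  is_MLE_SLC0 X (fun x => expeR (psi x)) <->
  (forall t : R, 0 <= t <= abs_max X ->
     (\int[lebesgue_measure]_(x in `[t, abs_max X]) Ghat_plus_R X psi x
      <= \int[lebesgue_measure]_(x in `[t, abs_max X]) (Fn_plus_R X x)%:E)%E) /\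
  (forall t : R, 0 <= t <= abs_max X ->
     knots (- abs_max X) (abs_max X) (fun x => fine (psi x)) t ->
     (\int[lebesgue_measure]_(x in `[t, abs_max X]) Ghat_plus_R X psi x
      = \int[lebesgue_measure]_(x in `[t, abs_max X]) (Fn_plus_R X x)%:E)%E).
Proof.
have [phi [SCphi psiE I1]] := psi_SLC0.
have psi_phi : psi = phi.
  by apply/funext => x; apply: expeR_inj; move/(congr1 (fun f => f x)): psiE.
rewrite -{}psi_phi {phi psiE} in SCphi I1.
have M0 := abs_max_gt0 _ _ n_gt0 X psi I1 psi_out.
have [C [L [L1 L2 psiE]]] :=
  tent_representation psi _ M0 SCphi psi_fin psi_pl psi_out.
clear SCphi psi_SLC0 psi_fin psi_pl psi_knots psi_out.
subst psi; set M := abs_max X in M0 *.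
have IL : \int[lebesgue_measure]_(x in `[- M, M]) expR (tent C L x) = 1.
  by apply: EFin_inj; rewrite -I1 integral_expR_tent.
pose gap t := sample_mean X (hinge t) -
  \int[lebesgue_measure]_(x in `[- M, M]) (hinge t x * expR (tent C L x)).
have gap_out t : M <= t -> gap t = 0.
  move=> Mt; rewrite /gap /sample_mean big1; last first.
    by move=> i _; rewrite (hinge_out M)// norm_le_abs_max.
  rewrite mulr0 sub0r (@eq_Rintegral _ _ _ _ _ (cst 0)).
    by rewrite Rintegral_cst// mul0r oppr0.
  move=> x; rewrite inE /= in_itv /= -ler_norml => xM.
  by rewrite (hinge_out M) ?mul0r.
have fE x : `|x| <= M -> fine (tent_log_density M C L x) = tent C L x.
  by rewrite /tent_log_density => ->.
have knotP := tent_knotP _ M C L _ fE L1 L2.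
have mle := is_MLE_tentP n_gt0 X M0 C L L1 L2.
split.
- move=> /mle opt.
  have [gap0 gapL] := tent_objective_necessary X M M0 C L L1 L2 IL
    (opt C).
  split => t tM; rewrite integral_Ghat// integral_Fn//.
    by rewrite lee_fin -subr_ge0 gap0//; case/andP: tM.
  move=> kt; congr EFin; apply/esym/eqP; rewrite -subr_eq0; apply/eqP.
  have [tltM|] := ltP t M; last exact: gap_out.
  have /andP[t0 _] := tM.
  have /knotP[|k [kL k0 <-]] := kt; first by rewrite t0.
  exact: gapL.
- move=> [ineq eqk]; apply/mle.
  have gap0 t : 0 <= t -> 0 <= gap t.
    move=> t0; have [tM|] := ltP t M; last by move/gap_out ->.
    rewrite subr_ge0 -lee_fin -integral_Ghat ?t0 ?(ltW tM)//.
    by rewrite -integral_Fn ?t0 ?(ltW tM)// ineq// t0 ltW.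
  apply: (tent_objective_max X M n_gt0 C L IL gap0) => k kL.
  have k2 := allP L2 _ kL; have k1 := allP L1 _ kL.
  have [kM|] := ltP k.2 M; last by move/gap_out => g0; rewrite -/(gap _) g0 mulr0.
  move: k1; rewrite le_eqVlt => /predU1P[<-|k0]; first by rewrite mul0r.
  have kin : 0 <= k.2 <= M by rewrite k2 ltW.
  have := eqk k.2 kin; rewrite integral_Ghat// integral_Fn//.
  have kt : knots (- M) M (fun x => fine (tent_log_density M C L x)) k.2.
    by apply/knotP; [rewrite k2|exists k].
  by move=> /(_ kt) [<-]; rewrite subrr mulr0.
Qed.
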